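(* Let $\mathbf{I} = (X,f,x_0)$ be a minimal iterator with $X$ a finite set. (1) Let $X_P = \{ x \in X : x \text{ is periodic} \}$. Then $X_P$ is non-empty and $X_x = X_y$ for all $x, y \in X_P$. Thus $f$ maps $X_P$ bijectively onto itself. (2) Let $X_N = \{ x \in X : x \text{ is not periodic} \}$ and suppose $X_N \ne \varnothing$. Then $f$ is injective on $X_N$ and there exists a unique element $u \in X_N$ such that $f(u)$ is periodic. Moreover, there exists a unique element $v \in X_P$ such that $f(v) = f(u)$, and $u$ and $v$ are the unique elements of $X$ with $u \ne v$ such that $f(u) = f(v)$ (that is, if $u', v' \in X$ with $u' \neq v'$ and $f(u') = f(v')$ then $\{u',v'\} = \{u,v\}$).
   Context: A set $E$ is finite if $\mathcal{P}(E)$ is the only subset $\mathcal{S}$ of the power set $\mathcal{P}(E)$ such that $\varnothing \in \mathcal{S}$ and $F \cup \{e\} \in \mathcal{S}$ whenever $F \in \mathcal{S}$, $F \neq E$ and $e \in E \setminus F$ (this is equivalent to the usual notion of finiteness). An iterator is a triple $\mathbf{I} = (X,f,x_0)$ with $f : X \to X$ a mapping and $x_0 \in X$. A subset $Y$ of $X$ is $f$-invariant if $f(y) \in Y$ for all $y \in Y$. $\mathbf{I}$ is minimal if the only $f$-invariant subset of $X$ containing $x_0$ is $X$ itself. For each $x \in X$ let $X_x$ be the least $f$-invariant subset of $X$ containing $x$ and let $f_x : X_x \to X_x$ be the restriction of $f$ to $X_x$. An element $x \in X$ is periodic if $x \in f_x(X_x)$. *)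

(* Defs.v *)
From mathcomp Require Import all_boot.
From mathcomp Require Import boolp classical_sets functions cardinality.

Set Implicit Arguments.
Unset Strict Implicit.
Unset Printing Implicit Defensive.

Local Open Scope classical_set_scope.

(* Finiteness of a type E by induction on its power set [set E]; see
   [ind_finiteP] for the agreement with [finite_set]. *)
Definition ind_finite (E : Type) : Prop :=
  forall S : set (set E),
    S set0 ->
    (forall (F : set E) (e : E),
        S F -> F <> [set: E] -> (~` F) e -> S (F `|` [set e])) ->
    S = [set: set E].

Lemma ind_finiteP (E : Type) : ind_finite E <-> finite_set [set: E].
Proof.
split=> [finE|finE S S0 SU].
  have -> // : @finite_set E = [set: set E].
  apply: finE => [|F e finF _ _]; first exact: finite_set0.
  by rewrite finite_setU; split=> //; exact: finite_set1.
apply/seteqP; split=> // F _.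
have : finite_set F by exact: sub_finite_set finE.
case=> n; elim: n F => [|n IHn] F.
  by rewrite II0 card_eq0 => /eqP ->.
move=> /eq_cardSP[x Fx /IHn SFx].
have nFx : ~ (F `\ x) x by case=> _; apply.
rewrite -(setD1K Fx) setUC; apply: (SU _ _ SFx _ nFx) => FxT.
by apply: nFx; rewrite FxT.
Qed.

Definition is_invariant (X : Type) (f : X -> X) (Y : set X) : Prop :=
  set_fun Y Y f.

Definition is_minimal (X : Type) (f : X -> X) (x0 : X) : Prop :=
  forall Y : set X, is_invariant f Y -> Y x0 -> Y = [set: X].

Definition orbit_of (X : Type) (f : X -> X) (x : X) : set X :=
  smallest (is_invariant f) [set x].

Lemma orbit_of_invariant (X : Type) (f : X -> X) (x : X) :
  is_invariant f (orbit_of f x).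
Proof. by move=> y xy Y YP; have [fY _] := YP; exact: fY (xy _ YP). Qed.

(* With X_x = [orbit_of f x] and f_x the restriction of [f] to X_x, the set
   f_x(X_x) is the image of X_x under [f]. *)
Definition periodic (X : Type) (f : X -> X) (x : X) : Prop :=
  (f @` orbit_of f x) x.

Definition periodic_set (X : Type) (f : X -> X) : set X :=
  [set x | periodic f x].

Definition nonperiodic_set (X : Type) (f : X -> X) : set X :=
  [set x | ~ periodic f x].

(* Main.v *)
Require Import Defs.
From mathcomp Require Import all_boot.
From mathcomp Require Import boolp classical_sets functions cardinality.

(** In a minimal iterator the points are the iterates of [x0], so any two
    distinct points are linearly related: one of them lies in the orbit of the
    image of the other ([minimal_orbit_total]).  A point is periodic exactly
    when it lies in the orbit of its own image ([periodicE]), and everything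
    follows by comparing these two facts.

    Periodic points have symmetric orbits: [x] can be reached again from each
    point of its orbit, so that point is periodic with the same orbit.  Hence
    [f] permutes the periodic points, and linearity leaves room for one cycle
    only.  Finiteness enters once, by pigeonhole: the iterates of a point
    cannot all be distinct, so each orbit meets the cycle.

    If [f a = f b] with [a <> b], linearity puts, say, [b] in the orbit of
    [f a = f b], so [b] is periodic ([collision_periodic]); as [f] is injective
    on the cycle, [a] is not.  So a collision always pairs a nonperiodic point
    that enters the cycle with the periodic preimage of its image.  Linearity
    again shows that there is one entrance only: if [u] and [u'] are distinct
    with periodic images, then one of them is in the orbit of the image of the
    other and thus is periodic. *)

Local Open Scope classical_set_scope.

(** * Orbits and periodic points *)

Lemma orbit_ofP {X : Type} {f : X -> X} {x y : X} :
  orbit_of f x y <-> exists n, y = iter n f x.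
Proof.
split=> [|[n ->]]; last first.
  elim: n => [|n IHn] /=; last exact: orbit_of_invariant.
  by move=> Y [_]; apply.
move=> /(_ [set z | exists n, z = iter n f x]); apply.
split=> [z [n ->]|z ->]; last by exists 0.
by exists n.+1.
Qed.

Lemma orbit_of_refl {X : Type} (f : X -> X) (x : X) : orbit_of f x x.
Proof. by apply/orbit_ofP; exists 0. Qed.

Lemma orbit_of_trans {X : Type} {f : X -> X} {x y z : X} :
  orbit_of f x y -> orbit_of f y z -> orbit_of f x z.
Proof.
move=> /orbit_ofP[m ->] /orbit_ofP[n ->].
by apply/orbit_ofP; exists (n + m); rewrite iterD.
Qed.

Lemma periodicE {X : Type} {f : X -> X} {x : X} :
  periodic f x <-> orbit_of f (f x) x.
Proof.
split=> [[y /orbit_ofP[n ->] fx]|/orbit_ofP[n xE]].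
  by apply/orbit_ofP; exists n; rewrite -iterSr.
exists (iter n f x); first by apply/orbit_ofP; exists n.
by rewrite -iterS iterSr.
Qed.

Lemma periodicP {X : Type} {f : X -> X} {x : X} :
  periodic f x <-> exists p, iter p.+1 f x = x.
Proof.
rewrite periodicE orbit_ofP.
by split=> -[p pE]; exists p; rewrite ?iterSr // -iterSr.
Qed.

Lemma iter_period_mul {X : Type} {f : X -> X} {x : X} {p : nat} (k : nat) :
  iter p f x = x -> iter (k * p) f x = x.
Proof. by move=> px; elim: k => [//|k IHk]; rewrite mulSn iterD IHk. Qed.

(** After [n] steps away from [x], walking on to the [n]-th multiple of a
    period leads back to [x]. *)
Lemma periodic_orbit_sym {X : Type} {f : X -> X} {x y : X} :
  periodic f x -> orbit_of f x y -> orbit_of f y x.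
Proof.
move=> /periodicP[p px] /orbit_ofP[n ->].
apply/orbit_ofP; exists (n * p).
by rewrite -iterD addnC -mulnS iter_period_mul.
Qed.

Lemma periodic_orbit {X : Type} {f : X -> X} {x y : X} :
  periodic f x -> orbit_of f x y -> periodic f y.
Proof.
move=> /periodicP[p px] /orbit_ofP[n ->].
by apply/periodicP; exists p; rewrite -iterD addnC iterD px.
Qed.

Lemma periodic_image {X : Type} {f : X -> X} {x : X} :
  periodic f x -> periodic f (f x).
Proof. by move=> px; apply: periodic_orbit px _; apply/orbit_ofP; exists 1. Qed.

Lemma periodic_inj {X : Type} (f : X -> X) : set_inj (periodic_set f) f.
Proof.
move=> x y /set_mem/periodicP[p px] /set_mem/periodicP[q qy] fxy.
(* the product of the periods is a positive common period, so that x and y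
   are the same iterate of their common image *)
rewrite -(iter_period_mul q.+1 px) -[RHS](iter_period_mul p.+1 qy).
by rewrite [in RHS]mulnC mulSn addSn !iterSr fxy.
Qed.

Lemma periodic_bij {X : Type} (f : X -> X) :
  set_bij (periodic_set f) (periodic_set f) f.
Proof.
split; [by move=> x; exact: periodic_image | exact: periodic_inj |].
by move=> y py; have [x xy fxy] := py; exists x => //; exact: periodic_orbit xy.
Qed.

(** Two equal iterates of indices [i < j] make the earlier one periodic, with
    period [j - i]. *)
Lemma finite_orbit_periodic {X : Type} (f : X -> X) (x : X) :
  ind_finite X -> exists2 y, orbit_of f x y & periodic f y.
Proof.
move=> /ind_finiteP finX; apply: contrapT => noper.
have lt_neq i j : i < j -> iter i f x <> iter j f x.
  move=> ij eqij; apply: noper; exists (iter i f x).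
    by apply/orbit_ofP; exists i.
  apply/periodicP; exists (j - i).-1.
  by rewrite prednK ?subn_gt0// -iterD subnK// ltnW.
apply: infinite_nat; rewrite -(preimage_setT (fun n => iter n f x)).
apply: finite_preimage finX => i j _ _ eqij.
by case: (ltngtP i j) => // /lt_neq; rewrite eqij.
Qed.

(** If no nonperiodic point had a periodic image, then the nonperiodic points
    would be invariant, and an orbit starting there would contain no periodic
    point, against [finite_orbit_periodic]. *)
Lemma exists_entrance {X : Type} (f : X -> X) :
  ind_finite X -> nonperiodic_set f !=set0 ->
  exists2 u, ~ periodic f u & periodic f (f u).
Proof.
move=> X_fin [x npx]; apply: contrapT => noentr.
have [y xy py] := finite_orbit_periodic f x X_fin.
suff : nonperiodic_set f y by apply.
apply: (xy (nonperiodic_set f)); split=> [z npz pfz|z -> //].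
by apply: noentr; exists z.
Qed.

(** * Minimal iterators *)

Section Minimal.
Context {X : Type} {f : X -> X} {x0 : X} (f_min : is_minimal f x0).

Lemma minimal_orbitT : orbit_of f x0 = [set: X].
Proof. by apply: f_min; [exact: orbit_of_invariant | exact: orbit_of_refl]. Qed.

(** If [a] and [b] are the iterates of index [i < j] of [x0], then [b] is the
    iterate of index [j - i.+1] of [f a]. *)
Lemma minimal_orbit_total (a b : X) :
  a <> b -> orbit_of f (f a) b \/ orbit_of f (f b) a.
Proof.
have /orbit_ofP[i ->] : orbit_of f x0 a by rewrite minimal_orbitT.
have /orbit_ofP[j ->] : orbit_of f x0 b by rewrite minimal_orbitT.
have later k l : k < l -> orbit_of f (f (iter k f x0)) (iter l f x0).
  by move=> kl; apply/orbit_ofP; exists (l - k.+1); rewrite -iterS -iterD subnK.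
by case: (ltngtP i j) => [/later|/later|->] //; [left|right].
Qed.

Lemma periodic_orbit_eq (x y : X) :
  periodic f x -> periodic f y -> orbit_of f x = orbit_of f y.
Proof.
have eq_orb a b : periodic f a -> orbit_of f a b -> orbit_of f a = orbit_of f b.
  move=> pa ab; apply/seteqP; split=> z; last exact: orbit_of_trans ab.
  by apply: orbit_of_trans; exact: periodic_orbit_sym ab.
move=> px py; have [->//|/minimal_orbit_total xy] := pselect (x = y).
have step z : orbit_of f z (f z) by apply/orbit_ofP; exists 1.
case: xy => [/(orbit_of_trans (step x))|/(orbit_of_trans (step y))].
  exact: eq_orb.
by move=> yx; apply/esym/eq_orb.
Qed.

Lemma collision_periodic (a b : X) :
  a <> b -> f a = f b -> periodic f a \/ periodic f b.
Proof.
move=> /minimal_orbit_total[] ab fab; [right|left]; apply/periodicE.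
  by rewrite -fab.
by rewrite fab.
Qed.

Lemma nonperiodic_inj : set_inj (nonperiodic_set f) f.
Proof.
move=> a b /set_mem npa /set_mem npb fab.
by apply: contrapT => /collision_periodic -/(_ fab)[].
Qed.

(** Everything reached from a periodic image is periodic, so neither of two
    distinct points that enter the cycle could come after the other. *)
Lemma entrance_unique (u u' : X) :
  ~ periodic f u -> periodic f (f u) ->
  ~ periodic f u' -> periodic f (f u') -> u = u'.
Proof.
move=> npu pfu npu' pfu'; apply: contrapT => /minimal_orbit_total[].
  by move/(periodic_orbit pfu).
by move/(periodic_orbit pfu').
Qed.

End Minimal.

Theorem theorem9p1 (X : Type) (f : X -> X) (x0 : X)
    (X_fin : ind_finite X) (I_min : is_minimal f x0) :
  (periodic_set f !=set0
   /\ (forall x y : X,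
          periodic_set f x -> periodic_set f y -> orbit_of f x = orbit_of f y)
   /\ set_bij (periodic_set f) (periodic_set f) f)
  /\
  (nonperiodic_set f !=set0 ->
   set_inj (nonperiodic_set f) f
   /\ exists u : X,
        unique (fun u' : X => nonperiodic_set f u' /\ periodic f (f u')) u
        /\ exists v : X,
             unique (fun v' : X => periodic_set f v' /\ f v' = f u) v
             /\ u <> v
             /\ f u = f v
             /\ (forall u' v' : X,
                    u' <> v' -> f u' = f v' -> [set u'; v'] = [set u; v])).
Proof.
split.
  split; last by split; [exact: periodic_orbit_eq I_min | exact: periodic_bij].
  by have [y _ py] := finite_orbit_periodic f x0 X_fin; exists y.
move=> /(exists_entrance f X_fin)[u npu pfu].
split; first exact: nonperiodic_inj I_min.
exists u; split.
  by split=> // u' [npu' pfu']; exact: (entrance_unique I_min).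
have [_ _ /(_ _ pfu)[v pv fvu]] := periodic_bij f.
have uniq_v v' : periodic f v' -> f v' = f u -> v = v'.
  by move=> pv' fv'; apply: (periodic_inj f); rewrite ?inE// fv'.
exists v; split; first by split=> // v' [pv' fv']; exact: uniq_v.
split; first by move=> uv; apply: npu; rewrite uv.
split=> // u' v' u'v' fu'v'.
have pair a b : a <> b -> f a = f b -> periodic f b -> a = u /\ b = v.
  move=> ab fab pb.
  have npa : ~ periodic f a.
    by move=> pa; apply: ab; apply: (periodic_inj f) => //; rewrite inE.
  have au : a = u.
    apply: (entrance_unique I_min) => //.
    by rewrite fab; exact: periodic_image.
  by split=> //; apply/esym/uniq_v; rewrite // -fab au.
case: (collision_periodic I_min _ _ u'v' fu'v') => [pu'|pv'].
  have [-> ->] := pair _ _ (nesym u'v') (esym fu'v') pu'.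
  by rewrite setUC.
by have [-> ->] := pair _ _ u'v' fu'v' pv'.
Qed.
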